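(* There exists an absolute constant $C>0$ such that for every integer $d\geq 1$, $$R_{\mathbb{F}_{2}}(2,d) \leq Cd^{7}.$$
   Context: For positive integers $s$ and $d$, $R_{\mathbb{F}_{2}}(s,d)$ denotes the smallest integer $n$ such that in every red-blue coloring of all the one-dimensional subspaces of $\mathbb{F}_{2}^{n}$ there must exist either a $d$-dimensional (linear) subspace all of whose one-dimensional subspaces are colored red, or an $s$-dimensional (linear) subspace all of whose one-dimensional subspaces are colored blue. (This quantity is finite for all $s,d$ by a theorem of Graham, Leeb and Rothschild.) *)

(* Defs.v *)
From HB Require Import structures.
From mathcomp Require Import all_boot all_order all_algebra.
From mathcomp Require Import reals.
Set Implicit Arguments.
Unset Strict Implicit.
Unset Printing Implicit Defensive.

Local Open Scope ring_scope.

Definition line (n : nat) := {L : {vspace 'rV['F_2]_n} | \dim L == 1%N}.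

Variant color := Red | Blue.

Definition monochromatic (n : nat) (chi : line n -> color) (c : color)
    (U : {vspace 'rV['F_2]_n}) : Prop :=
  forall L : line n, (val L <= U)%VS -> chi L = c.

Definition ramsey_property (s d n : nat) : Prop :=
  forall chi : line n -> color,
    (exists2 U : {vspace 'rV['F_2]_n}, \dim U = d & monochromatic chi Red U)
    \/
    (exists2 U : {vspace 'rV['F_2]_n}, \dim U = s & monochromatic chi Blue U).

(* The Ramsey number R_{F_2}(s,d) is given by its graph, so that no default
   value is needed; [is_ramsey_number s d n] reads "R_{F_2}(s,d) = n". *)
Definition is_ramsey_number (s d n : nat) : Prop :=
  ramsey_property s d n /\
  forall m : nat, ramsey_property s d m -> (n <= m)%N.

Lemma is_ramsey_number_unique (s d n m : nat) :
  is_ramsey_number s d n -> is_ramsey_number s d m -> n = m.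
Proof.
move=> [Pn minn] [Pm minm]; apply/eqP.
by rewrite eqn_leq minn // minm.
Qed.

(* Main.v *)
Require Import Defs.
From HB Require Import structures.
From mathcomp Require Import all_boot all_order all_algebra.
From mathcomp Require Import reals.
From mathcomp Require Import boolp sequences exp.
From mathcomp Require Import ring lra zify.
Set Implicit Arguments.
Unset Strict Implicit.
Unset Printing Implicit Defensive.
Import Order.TTheory GRing.Theory Num.Theory.
Local Open Scope ring_scope.

(** Let B be the set of blue points of V = F_2^n.  If B has density below 2^-d,
a d-dimensional subspace missing B can be built greedily, and it is red.
Otherwise it is enough to find a d-dimensional subspace all of whose nonzero
points are sums of two points of B: if such a point y + z is itself blue then
y, z and y + z span a blue plane, and if no such point is blue then the subspace
is red.

That subspace comes from a density increment in the style of Kelley and Meka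
([subspace_in_sumset]).  Let A have density alpha >= 2^-d.  If A + A misses a
proportion less than 2^-d of V, the greedy construction applies to the complement
of A + A.  If it misses more, [density_increment] yields a coset of a subspace of
codimension O(d^6) on which the density of A is at least 11/8 alpha.  In
characteristic 2 a translation does not change A + A, so one may replace A by its
trace on that coset and start again.  A density is at most 1, hence O(d) rounds
are enough and the codimension spent is O(d^7).

The increment is obtained as follows.  Let f be the autocorrelation of A,
normalised to have mean 1; it vanishes off A + A.  Since f - 1 has nonnegative
Fourier coefficients, f cannot often be far below 1 without being far above 1 as
well: its q-th moment is exponentially large for q of order d
([selfconv_moment]).  Dependent random choice ([sift]) turns this into a set B of
density 2^-O(d^2) such that almost all pairs of points of B have their sum in the
set S where f >= 3/2.  Random sampling ([almost_period]) gives a set T of density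
2^-O(d^6) of almost periods of the convolution of B and S, and averaging over
sums of 2k elements of T, with k of order d, preserves the popularity of S
([smooth_popular]).  On the Fourier side this averaging multiplies by the 2k-th
power of the transform of T, which damps all characters outside the large
spectrum of T; as the rest is controlled by the Parseval identity for A, it
suffices that 4^k exceeds a multiple of 1/alpha.  So the Fourier energy of A on
the large spectrum of T is at least 11/8 alpha^2 ([large_spectral_energy]).  By
Chang's theorem ([chang]) that spectrum spans a space of dimension O(d^6), and
the energy of A on a space of characters counts the pairs of points of A lying in
the same coset of its annihilator ([hat_energy]); some coset must then be dense. *)

(** * Characters, Fourier transform and convolution on F_2^n *)

Lemma le_of_eq (R : realType) (x y : R) : x = y -> x <= y.
Proof. by move=> ->. Qed.

Lemma F2P (a : 'F_2) : a = 0 \/ a = 1.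
Proof. by case: a => [[|[|?]] ?] //; [left|right]; apply/val_inj. Qed.

Section Fourier.
Variables (R : realType) (n : nat).
Local Notation V := 'rV['F_2]_n.
Implicit Types (f g h : V -> R) (r s x y z : V).

Lemma addvv x : x + x = 0.
Proof.
apply/rowP=> i; rewrite !mxE.
by case: (x 0 i) => [[|[|?]] ?] //; apply/val_inj.
Qed.

Lemma addvK x : involutive (+%R x).
Proof. by move=> y; rewrite addrA addvv add0r. Qed.

Lemma addv_eq0 x y : (x + y == 0) = (x == y).
Proof.
apply/eqP/eqP => [xy|->]; last exact: addvv.
by rewrite -[y](addvK x) xy addr0.
Qed.

Lemma sum_shift f x : \sum_y f (x + y) = \sum_y f y.
Proof. by rewrite [RHS](reindex_inj (addrI x)). Qed.

(** The exponent is an element of F_2, read as the natural number 0 or 1. *)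
Definition character r x : R := (-1) ^+ ((r *m x^T) 0 0).

Lemma signF2D (a b : 'F_2) : (-1) ^+ (a + b)%R = (-1) ^+ a * (-1) ^+ b :> R.
Proof.
case: a b => [[|[|?]] ?] [[|[|?]] ?] //=.
- exact: esym (mulr1 1).
- exact: esym (mul1r (-1)).
- exact: esym (mulr1 (-1)).
- by rewrite expr1 mulrNN mulr1.
Qed.

Lemma characterDr r x y : character r (x + y) = character r x * character r y.
Proof. by rewrite /character linearD /= mulmxDr mxE signF2D. Qed.

Lemma characterC r x : character r x = character x r.
Proof.
rewrite /character.
have -> : (r *m x^T) 0 0 = (r *m x^T)^T 0 0 by rewrite [RHS]mxE.
by rewrite trmx_mul trmxK.
Qed.

Lemma characterDl r s x : character (r + s) x = character r x * character s x.
Proof. by rewrite !(characterC _ x) characterDr. Qed.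

Lemma character0 r : character r 0 = 1.
Proof. by rewrite /character trmx0 mulmx0 mxE expr0. Qed.

Lemma norm_character r x : `|character r x| = 1.
Proof. by rewrite /character normrX normrN1 expr1n. Qed.

(** A nontrivial character takes the value -1 at some x0, so translating by x0
negates the sum. *)
Lemma sum_character r : \sum_x character r x = if r == 0 then #|{: V}|%:R else 0.
Proof.
case: eqP => [->|/eqP r0].
  under eq_bigr do rewrite characterC character0.
  by rewrite sumr_const.
have [x0 cx0] : exists x0, character r x0 = -1.
  have /rV0Pn[i ri] := r0; exists (delta_mx 0 i).
  rewrite /character trmx_delta -colE mxE.
  by move: ri; case: (r 0 i) => [[|[|?]] ?] //; rewrite expr1.
have := sum_shift (character r) x0.
under eq_bigr do rewrite characterDr cx0 mulN1r.
rewrite sumrN => /eqP; rewrite eq_sym -subr_eq0 opprK -mulr2n mulrn_eq0 /=.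
by move/eqP.
Qed.

Definition hat f r : R := \sum_x f x * character r x.

(** The usual convolution: y - x and x + y agree in characteristic 2.  Neither
this nor [hat] is normalised. *)
Definition conv f g x : R := \sum_y f y * g (x + y).

Lemma convC f g : conv f g = conv g f.
Proof.
apply/funext => x; rewrite /conv (reindex_inj (addrI x)).
by apply: eq_bigr => y _; rewrite addvK mulrC.
Qed.

Lemma convA f g h : conv f (conv g h) = conv (conv f g) h.
Proof.
apply/funext => x; rewrite /conv.
under [RHS]eq_bigr do rewrite mulr_suml.
rewrite [RHS]exchange_big /=; apply: eq_bigr => y _.
rewrite mulr_sumr [RHS](reindex_inj (addrI y)) /=; apply: eq_bigr => z _.
by rewrite [y + z + y]addrC addvK !addrA mulrA.
Qed.

Lemma hat_conv f g r : hat (conv f g) r = hat f r * hat g r.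
Proof.
rewrite /hat /conv mulr_suml.
under eq_bigr do rewrite mulr_suml.
rewrite exchange_big /=; apply: eq_bigr => y _.
rewrite mulr_sumr (reindex_inj (addrI y)) /=; apply: eq_bigr => x _.
by rewrite [y + x]addrC -addrA addvv addr0 characterDr; ring.
Qed.

Lemma sum_hat f : \sum_r hat f r = #|{: V}|%:R * f 0.
Proof.
rewrite /hat exchange_big /=.
under eq_bigr => x _.
  rewrite -mulr_sumr; under eq_bigr do rewrite characterC.
  rewrite sum_character; over.
rewrite (bigD1 0) //= eqxx big1 ?addr0 1?mulrC // => x /negPf ->.
exact: mulr0.
Qed.

(** This is what makes nonnegativity of Fourier coefficients stable under
pointwise products. *)
Lemma hatM f g r :
  #|{: V}|%:R * hat (fun x => f x * g x) r = conv (hat f) (hat g) r.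
Proof.
transitivity (\sum_x \sum_s f x * character s x * hat g (r + s)); last first.
  rewrite exchange_big /=; apply: eq_bigr => s _.
  by rewrite /hat -mulr_suml.
rewrite mulr_sumr; apply: eq_bigr => x _.
transitivity (f x * character r x * \sum_s hat (fun y => g (x + y)) s); last first.
  rewrite mulr_sumr [RHS](reindex_inj (addrI r)) /=; apply: eq_bigr => s _.
  rewrite addvK characterDl -!mulrA; congr (_ * (_ * _)).
  rewrite /hat mulr_sumr (reindex_inj (addrI x)) /=.
  apply: eq_bigr => y _; rewrite addvK characterDr; ring.
rewrite sum_hat addr0; ring.
Qed.
End Fourier.

(** * Moments of the autocorrelation and dependent random choice *)

Section Sift.
Variables (R : realType) (n : nat).
Local Notation V := 'rV['F_2]_n.
Local Notation N := (#|{: 'rV['F_2]_n}|%:R : R).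
Implicit Types (f g h : V -> R) (r s x y z : V) (A B S : {set V}).

Definition indicator A x : R := (x \in A)%:R.

Local Notation ind := indicator.

Lemma ind_ge0 A x : 0 <= ind A x. Proof. exact: ler0n. Qed.

Lemma ind_le1 A x : ind A x <= 1. Proof. by rewrite /indicator; case: (x \in A). Qed.

Lemma sum_ind A : \sum_x ind A x = #|A|%:R.
Proof.
by rewrite /indicator -natr_sum -sum1_card [in RHS]big_mkcond.
Qed.

Lemma card_space_gt0 : 0 < N.
Proof. by rewrite ltr0n; apply/card_gt0P; exists 0. Qed.

Lemma hat_at0 f : hat f 0 = \sum_x f x.
Proof. by apply: eq_bigr => x _; rewrite characterC character0 mulr1. Qed.

Lemma hat_ext f g r : f =1 g -> hat f r = hat g r.
Proof. by move=> fg; apply: eq_bigr => x _; rewrite fg. Qed.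

Lemma hatD f g r : hat (fun x => f x + g x) r = hat f r + hat g r.
Proof. by rewrite -big_split; apply: eq_bigr => x _; rewrite mulrDl. Qed.

Lemma hatZ (c : R) f r : hat (fun x => c * f x) r = c * hat f r.
Proof. by rewrite mulr_sumr; apply: eq_bigr => x _; rewrite mulrA. Qed.

Lemma hat_cst (c : R) r : hat (fun=> c) r = if r == 0 then c * N else 0.
Proof. by rewrite /hat -mulr_sumr sum_character; case: eqP; rewrite ?mulr0. Qed.

Lemma conv_ind_ge0 A B x : 0 <= conv (ind A) (ind B) x.
Proof. by apply: sumr_ge0 => y _; rewrite mulr_ge0 ?ind_ge0. Qed.

(** By Bochner's theorem these are the positive definite functions. *)
Definition posdef f := forall r, 0 <= hat f r.

Lemma posdefD f g : posdef f -> posdef g -> posdef (fun x => f x + g x).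
Proof. by move=> pf pg r; rewrite hatD addr_ge0. Qed.

Lemma posdefM f g : posdef f -> posdef g -> posdef (fun x => f x * g x).
Proof.
move=> pf pg r; rewrite -(pmulr_rge0 _ card_space_gt0) hatM.
by apply: sumr_ge0 => s _; rewrite mulr_ge0.
Qed.

(** The odd part in nu of (1 + nu)^q is a polynomial in nu with nonnegative
coefficients, hence positive definite, and so has a nonnegative mean.  The
induction carries the even part along. *)
Lemma unbalance nu q : posdef nu ->
  \sum_x (1 - nu x) ^+ q <= \sum_x (1 + nu x) ^+ q.
Proof.
move=> pnu.
suff [pD _] : posdef (fun x => (1 + nu x) ^+ q - (1 - nu x) ^+ q)
   /\ posdef (fun x => (1 + nu x) ^+ q + (1 - nu x) ^+ q).
  by have := pD 0; rewrite hat_at0 sumrB subr_ge0.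
elim: q => [|q [pB pD]].
  split=> r; under hat_ext do rewrite !expr0; rewrite hat_cst.
    by case: ifP => // _; rewrite subrr mul0r.
  by case: ifP => // _; rewrite mulr_ge0 ?addr_ge0 ?ler0n.
split=> r.
- rewrite (@hat_ext _ (fun x => ((1 + nu x) ^+ q - (1 - nu x) ^+ q) +
      nu x * ((1 + nu x) ^+ q + (1 - nu x) ^+ q))).
    by apply: posdefD => //; apply: posdefM.
  by move=> x; rewrite !exprS; ring.
- rewrite (@hat_ext _ (fun x => ((1 + nu x) ^+ q + (1 - nu x) ^+ q) +
      nu x * ((1 + nu x) ^+ q - (1 - nu x) ^+ q))).
    by apply: posdefD => //; apply: posdefM.
  by move=> x; rewrite !exprS; ring.
Qed.

(** Normalised so that its mean over the whole space is 1. *)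
Definition selfconv A x : R := N / #|A|%:R ^+ 2 * conv (ind A) (ind A) x.

(** The Fourier coefficients of the autocorrelation f are squares, and
subtracting 1 from f only turns the one at 0 into 0.  So [unbalance] applies to
nu = f - 1: the moment of f is at least that of 2 - f, which equals 2 wherever f
vanishes. *)
Lemma selfconv_moment A q : (0 < #|A|)%N -> ~~ odd q ->
  #|[set x | selfconv A x == 0]|%:R * 2 ^+ q <= \sum_x selfconv A x ^+ q.
Proof.
move=> A0 q2; set C := [set _ | _].
have a0 : #|A|%:R != 0 :> R by rewrite pnatr_eq0 -lt0n.
pose nu x := selfconv A x - 1.
have pnu : posdef nu.
  move=> r; rewrite /nu (hatD (selfconv A) (fun=> -1)) hatZ hat_cst hat_conv.
  case: eqP => [->|_]; last first.
    by rewrite addr0 mulr_ge0 ?divr_ge0 ?exprn_ge0 ?ler0n // -expr2 sqr_ge0.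
  by rewrite hat_at0 sum_ind -expr2 mulfVK ?expf_neq0 // mulN1r subrr.
have := unbalance q pnu; under [leRHS]eq_bigr do rewrite subrKC.
apply: le_trans; rewrite -sum_ind mulr_suml; apply: ler_sum => x _.
rewrite /indicator inE /nu; case: eqP => [->|_].
  by rewrite mul1r sub0r opprK.
by rewrite mul0r exprn_even_ge0.
Qed.

(** The intersection of the translates A + s i. *)
Definition shiftcap q A (s : {ffun 'I_q -> V}) :=
  [set y | [forall i, y + s i \in A]].

Lemma ind_shiftcap q A (s : {ffun 'I_q -> V}) y :
  ind (shiftcap A s) y = \prod_i ind A (y + s i).
Proof.
rewrite /indicator inE; case: forallP => [As|/forallP].
  by rewrite big1 // => i _; rewrite As.
by rewrite negb_forall => /existsP[i /negPf Ai]; rewrite (bigD1 i) //= Ai mul0r.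
Qed.

(** For random shifts s, two points whose sum is x both lie in the intersection
with probability proportional to the q-th power of the autocorrelation at x.
Thus random intersections favour pairs with a popular sum. *)
Lemma sum_shiftcap q A g :
  \sum_(s : {ffun 'I_q -> V}) \sum_x
     g x * conv (ind (shiftcap A s)) (ind (shiftcap A s)) x
  = N * \sum_x g x * conv (ind A) (ind A) x ^+ q.
Proof.
rewrite exchange_big mulr_sumr; apply: eq_bigr => x _ /=.
rewrite -mulr_sumr mulrCA; congr (_ * _).
rewrite exchange_big /= mulr_natl -sumr_const; apply: eq_bigr => y _.
under eq_bigr do rewrite !ind_shiftcap -big_split /=.
rewrite -(bigA_distr_bigA (fun i z => ind A (y + z) * ind A (x + y + z))) /=.
rewrite -[q in RHS]card_ord -prodr_const; apply: eq_bigr => i _.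
rewrite /conv -[RHS](sum_shift _ y).
by apply: eq_bigr => z _; rewrite addrA.
Qed.

Lemma exists_ge_average (I : finType) (F : I -> R) (c : R) :
  #|I|%:R * c <= \sum_i F i -> (0 < #|I|)%N -> exists i, c <= F i.
Proof.
move=> cF I0; apply/existsP; apply/contraT; rewrite negb_exists => /forallP ltc.
have /card_gt0P[i0 _] := I0.
suff : \sum_i F i < #|I|%:R * c by rewrite ltNge cF.
rewrite mulr_natl -sumr_const; apply: ltr_sum => [|i _]; last by rewrite ltNge.
by apply/hasP; exists i0; rewrite // mem_index_enum.
Qed.

(** The value of q is dictated by (3/4)^4 < 1/2. *)
Lemma pow_gap (d q : nat) : (4 * (d + 6) <= q)%N ->
  64 * 2 ^+ d * (3 / 2) ^+ q <= 2 ^+ q :> R.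
Proof.
move=> dq; rewrite -(subnKC dq) !(exprD _ (4 * _)) mulrA.
have h2 : 0 <= 3 / 2 :> R by lra.
apply: ler_pM; rewrite ?mulr_ge0 ?exprn_ge0 ?ler0n //; last first.
  by apply: lerXn2r; rewrite ?nnegrE ?ler0n //; lra.
have -> : 64 * 2 ^+ d = 2 ^+ (d + 6) :> R by rewrite exprD; ring.
by rewrite ![_ ^+ (4 * _)]exprM -exprMn lerXn2r ?nnegrE //; lra.
Qed.

(** On the average over the shifts, the pairs in the intersection with an
unpopular sum, weighted by 32, are outnumbered by all pairs, because the q-th
moment is dominated by the points where [selfconv A] is at least 3/2.  A choice of
the shifts that is at least as good as the average gives both conclusions: the
weighted difference bounds the size of the intersection from below, and its
positivity bounds the share of unpopular sums. *)
Lemma sift A (q d : nat) : (0 < #|A|)%N -> ~~ odd q -> (4 * (d + 6) <= q)%N ->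
  N <= 2 ^+ d * #|[set x | selfconv A x == 0]|%:R ->
  exists B : {set V}, [/\ N * #|A|%:R ^+ q <= #|B|%:R * N ^+ q,
    (0 < #|B|)%N &
    31 / 32 * #|B|%:R ^+ 2 <=
      \sum_x conv (ind B) (ind B) x * ind [set x | 3 / 2 <= selfconv A x] x].
Proof.
move=> A0 q2 dq NC; set S := [set _ | _ <= _].
have N0 := card_space_gt0.
have a0 : 0 < #|A|%:R :> R by rewrite ltr0n.
pose g x : R := 1 - 32 * ind (~: S) x.
have mom := selfconv_moment A0 q2; set C := [set _ | _] in NC mom.
have f0 x : 0 <= selfconv A x.
  by rewrite mulr_ge0 ?divr_ge0 ?conv_ind_ge0 ?exprn_ge0 // ltW.
have gap := pow_gap dq.
(* The points outside S carry a negligible part of the q-th moment. *)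
have outside : \sum_x ind (~: S) x * selfconv A x ^+ q <= N * (3 / 2) ^+ q.
  rewrite mulr_natl -sumr_const; apply: ler_sum => x _.
  rewrite /indicator !inE; case: (lerP (3 / 2)) => [_|fx] /=.
    by rewrite mulr0n mul0r exprn_ge0; lra.
  by rewrite mulr1n mul1r lerXn2r ?nnegrE ?(ltW fx) //; lra.
have gsum : N <= \sum_x g x * selfconv A x ^+ q.
  have -> : \sum_x g x * selfconv A x ^+ q = \sum_x selfconv A x ^+ q
      - 32 * \sum_x ind (~: S) x * selfconv A x ^+ q.
    by rewrite mulr_sumr -sumrB; apply: eq_bigr => x _; rewrite /g; ring.
  have c2 : 64 * (N * (3 / 2) ^+ q) <= #|C|%:R * 2 ^+ q.
    have := ler_wpM2l (ler0n R #|C|) gap; apply: le_trans.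
    have q0 : 0 <= (3 / 2) ^+ q :> R by rewrite exprn_ge0; lra.
    have := ler_wpM2r q0 NC; nra.
  have : 1 <= (3 / 2) ^+ q :> R by rewrite exprn_ege1; lra.
  nra.
(* The square of the expected size of the intersection of q random translates. *)
pose c : R := (N * #|A|%:R ^+ q / N ^+ q) ^+ 2.
have [] := @exists_ge_average {ffun 'I_q -> V}
  (fun s : {ffun 'I_q -> V} =>
     \sum_x g x * conv (ind (shiftcap A s)) (ind (shiftcap A s)) x) c.
- rewrite sum_shiftcap.
  have -> : \sum_x g x * conv (ind A) (ind A) x ^+ q
      = (#|A|%:R ^+ 2 / N) ^+ q * \sum_x g x * selfconv A x ^+ q.
    rewrite mulr_sumr; apply: eq_bigr => x _; rewrite mulrCA -exprMn.
    congr (_ * _ ^+ _); rewrite /selfconv; field.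
    by rewrite !gt_eqF.
  rewrite card_ffun card_ord natrX.
  have -> : N ^+ q * c = N * ((#|A|%:R ^+ 2 / N) ^+ q * N).
    rewrite /c [(_ / N) ^+ q]expr_div_n -exprM mulnC exprM; field.
    by rewrite expf_neq0 // gt_eqF.
  by rewrite ler_pM2l // ler_wpM2l // exprn_ge0 // divr_ge0 // sqr_ge0.
- by rewrite card_ffun card_ord expn_gt0; apply/orP; left; apply/card_gt0P; exists 0.
move=> s; set B := shiftcap A s => cB; exists B.
have sumB : \sum_x conv (ind B) (ind B) x = #|B|%:R ^+ 2.
  by rewrite -hat_at0 hat_conv hat_at0 sum_ind expr2.
have split_g : \sum_x g x * conv (ind B) (ind B) x = #|B|%:R ^+ 2
    - 32 * \sum_x conv (ind B) (ind B) x * ind (~: S) x.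
  rewrite -sumB mulr_sumr -sumrB; apply: eq_bigr => x _; rewrite /g; ring.
have split_S : \sum_x conv (ind B) (ind B) x * ind S x = #|B|%:R ^+ 2
    - \sum_x conv (ind B) (ind B) x * ind (~: S) x.
  rewrite -sumB -sumrB; apply: eq_bigr => x _; rewrite /indicator in_setC.
  by case: (x \in S) => /=; ring.
have out0 : 0 <= \sum_x conv (ind B) (ind B) x * ind (~: S) x.
  by apply: sumr_ge0 => x _; rewrite mulr_ge0 ?conv_ind_ge0 ?ind_ge0.
have c0 : 0 < c by rewrite exprn_gt0 // divr_gt0 ?mulr_gt0 ?exprn_gt0.
split.
- rewrite -ler_pdivrMr ?exprn_gt0 //.
  have : c <= #|B|%:R ^+ 2 by lra.
  by rewrite ler_pXn2r ?nnegrE ?divr_ge0 ?mulr_ge0 ?exprn_ge0 ?ler0n.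
- rewrite -(ltr0n R) lt0r ler0n andbT; apply/eqP => b0.
  by move: cB; rewrite split_g b0 expr0n /=; lra.
- by rewrite split_S; lra.
Qed.

End Sift.

(** * Concentration and almost periods *)

Section Hoeffding.
Variables (R : realType).

(** Multiply 1 - x <= exp (- x) by (1 + x + 2 x^2), whose product with 1 - x is
at least 1 in this range. *)
Lemma expR_le_quadratic (x : R) : x <= 1 / 2 -> expR x <= 1 + x + 2 * x ^+ 2.
Proof.
move=> x_le; have := expR_ge1Dx (- x); have := expR_gt0 x.
have := expRxMexpNx_1 x; rewrite expr2; set u := expR x; set v := expR (- x).
move=> uv u0 hv.
have h1 : u * (1 - x) <= 1 by rewrite -[leRHS]uv ler_pM2l.
have h2 : 1 <= (1 + x + 2 * (x * x)) * (1 - x).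
  have : 0 <= x * x * (1 - 2 * x) by rewrite mulr_ge0 -?expr2 ?sqr_ge0 //; lra.
  lra.
by rewrite -(@ler_pM2r _ (1 - x)); lra.
Qed.

(** The linear term of the quadratic bound averages out. *)
Lemma mgf_le (T : finType) (B : {set T}) (h : T -> R) (l : R) :
  (forall y, `|h y| <= 1) -> \sum_(y in B) h y = 0 -> `|l| <= 1 / 2 ->
  \sum_(y in B) expR (l * h y) <= #|B|%:R * expR (2 * l ^+ 2).
Proof.
move=> h1 h0 l2.
apply: (@le_trans _ _ (\sum_(y in B) (1 + l * h y + 2 * l ^+ 2))).
  apply: ler_sum => y _; apply: le_trans (expR_le_quadratic _) _.
    apply: le_trans (ler_norm _) _; rewrite normrM.
    by have := h1 y; have := normr_ge0 l; have := normr_ge0 (h y); nra.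
  rewrite exprMn; have : h y ^+ 2 <= 1 by rewrite -real_normK ?num_real // expr_le1.
  have := sqr_ge0 l; nra.
rewrite !big_split /= -mulr_sumr h0 mulr0 addr0 !sumr_const.
by rewrite -mulrnDl -[leLHS]mulr_natl ler_wpM2l // expR_ge1Dx.
Qed.

Lemma sum_prod_ffun (T : finType) (m : nat) (B : {set T}) (F : T -> R) :
  \sum_(c : {ffun 'I_m -> T} | [forall i, c i \in B]) \prod_i F (c i)
  = (\sum_(y in B) F y) ^+ m.
Proof.
rewrite -[m in RHS]card_ord -prodr_const bigA_distr_big_dep /=.
by apply: eq_bigl => c; apply/forallP/familyP.
Qed.

(** The exponential moment method, with parameter e / 4. *)
Lemma hoeffding (T : finType) (m : nat) (B : {set T}) (h : T -> R) (e : R) :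
  (forall y, `|h y| <= 1) -> \sum_(y in B) h y = 0 -> 0 <= e <= 1 ->
  #|[set c : {ffun 'I_m -> T} | [forall i, c i \in B]
      && (e * m%:R < `|\sum_i h (c i)|)]|%:R
  <= 2 * (#|B|%:R ^+ m * expR (- (e ^+ 2 * m%:R / 8))).
Proof.
move=> h1 h0 e01; set bad := [set _ | _].
pose E l := \sum_(c : {ffun 'I_m -> T} | [forall i, c i \in B])
  expR (l * \sum_i h (c i)).
have E_le l : `|l| <= 1 / 2 -> E l <= #|B|%:R ^+ m * expR (2 * l ^+ 2 * m%:R).
  move=> l2; rewrite /E; under eq_bigr do rewrite mulr_sumr expR_sum.
  rewrite (sum_prod_ffun m B (fun y => expR (l * h y))) expRM_natr -exprMn.
  rewrite lerXn2r ?nnegrE ?mulr_ge0 ?expR_ge0 ?mgf_le //.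
  by apply: sumr_ge0 => y _; apply: expR_ge0.
(* This value minimises 2 l^2 m - l e m. *)
pose l := e / 4.
have lB : #|bad|%:R * expR (l * e * m%:R) <= E l + E (- l).
  rewrite -sum1_card natr_sum mulr_suml /E -big_split /=.
  rewrite [leRHS]big_mkcond [leLHS]big_mkcond /=; apply: ler_sum => c _.
  rewrite inE; case: ifP => [/andP[-> lt_e]|_]; last first.
    by case: ifP => // _; rewrite addr_ge0 ?expR_ge0.
  have l0 : 0 <= l by rewrite /l; lra.
  rewrite mul1r; set X := \sum_i _ in lt_e *.
  have [X0|X0] := lerP 0 X.
    rewrite ler_wpDr ?expR_ge0 // ler_expR -mulrA ler_wpM2l // ltW //.
    by rewrite -[X in _ < X]ger0_norm.
  rewrite ler_wpDl ?expR_ge0 // ler_expR -mulrA mulNr -mulrN ler_wpM2l // ltW //.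
  by rewrite -[X in _ < X]ltr0_norm.
have ll : `|l| <= 1 / 2 by rewrite ger0_norm /l; lra.
have := E_le l ll; have := E_le (- l); rewrite normrN sqrrN => /(_ ll) E1 E2.
rewrite -(ler_pM2r (expR_gt0 (l * e * m%:R))).
rewrite -[leRHS]mulrA -[X in 2 * X]mulrA -expRD.
have -> : - (e ^+ 2 * m%:R / 8) + l * e * m%:R = 2 * l ^+ 2 * m%:R.
  by rewrite /l; field.
by apply: le_trans lB _; lra.
Qed.

End Hoeffding.

Section CrootSisask.
Variables (R : realType) (n : nat).
Local Notation V := 'rV['F_2]_n.
Local Notation N := (#|{: 'rV['F_2]_n}|%:R : R).
Local Notation ind := (@indicator R n).
Implicit Types (f g h : V -> R) (r s t x y z : V) (A B S T : {set V}).

Definition average B S x : R := #|B|%:R^-1 * conv (ind B) (ind S) x.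

Lemma sum_mem B f : \sum_y ind B y * f y = \sum_(y in B) f y.
Proof.
rewrite [RHS]big_mkcond; apply: eq_bigr => y _ /=.
by rewrite /indicator; case: ifP => _; rewrite ?mul1r ?mul0r.
Qed.

Lemma average_ge0 B S x : 0 <= average B S x.
Proof. by rewrite mulr_ge0 ?invr_ge0 ?conv_ind_ge0. Qed.

Lemma average_le1 B S x : average B S x <= 1.
Proof.
have [B0|B0] := posnP #|B|; first by rewrite /average B0 invr0 mul0r.
rewrite /average mulrC ler_pdivrMr ?ltr0n // mul1r -sum_ind.
by apply: ler_sum => y _; rewrite ler_piMr ?ind_ge0 ?ind_le1.
Qed.

(** The argument of Croot and Sisask.  For at least half of the m-tuples c
of points of B, the mean of the translates of the indicator of S by the entries
of c approximates [average B S] outside a small set.  By pigeonhole some tuple c has many diagonal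
translates c + t that are good in this sense, and the approximant for c + t is a
translate by t of the one for c.  So all [average B S (t + _)], for those t, are
close to a single function g. *)
Lemma almost_period B S (m : nat) (e : R) : (0 < #|B|)%N -> (0 < m)%N ->
  0 <= e <= 1 ->
  exists (T : {set V}) (g : V -> R),
    [/\ N * #|B|%:R ^+ m <= 2 * #|T|%:R * N ^+ m,
       forall x, 0 <= g x <= 1 &
    forall t, t \in T ->
      #|[set x | e < `|average B S (t + x) - g x|]|%:R
      <= 4 * expR (- (e ^+ 2 * m%:R / 8)) * N].
Proof.
move=> B0 m0 e01; set d := expR _.
have N0 : 0 < N := card_space_gt0 R n.
have b0 : 0 < #|B|%:R :> R by rewrite ltr0n.
have d0 : 0 < d by apply: expR_gt0.
pose inB (c : {ffun 'I_m -> V}) := [forall i, c i \in B].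
pose bad (c : {ffun 'I_m -> V}) x :=
  e * m%:R < `|\sum_i (ind S (x + c i) - average B S x)|.
pose L := [set c | inB c && (#|[set x | bad c x]|%:R <= 4 * d * N)].
have bad_le x : #|[set c | inB c && bad c x]|%:R <= 2 * (#|B|%:R ^+ m * d).
  apply: (@hoeffding R V m B (fun y => ind S (x + y) - average B S x) e) => //.
    move=> y; have := ind_ge0 R S (x + y); have := ind_le1 R S (x + y).
    have := average_ge0 B S x; have := average_le1 B S x.
    by rewrite ler_norml; lra.
  rewrite sumrB sumr_const -[_ *+ _]mulr_natl /average mulVKf ?gt_eqF //.
  by rewrite -sum_mem subrr.
have L_big : #|B|%:R ^+ m <= 2 * #|L|%:R :> R.
  have cB : #|[set c | inB c]|%:R = #|B|%:R ^+ m :> R.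
    rewrite -natrX -[X in (_ ^ X)%N]card_ord -card_ffun_on; congr _%:R.
    apply: eq_card => c; rewrite inE; exact/forallP/ffun_onP.
  pose D := [set c | inB c && (4 * d * N < #|[set x | bad c x]|%:R)].
  have cLD : #|L|%:R + #|D|%:R = #|B|%:R ^+ m :> R.
    rewrite -cB -natrD; congr _%:R.
    rewrite -(cardsID L [set c | inB c]); congr (_ + _)%N; apply: eq_card => c;
      rewrite !inE; case: (inB c) => //=; by rewrite ltNge ?andbT.
  suff : 2 * #|D|%:R <= #|B|%:R ^+ m :> R by lra.
  have : #|D|%:R * (4 * d * N) <= N * (2 * (#|B|%:R ^+ m * d)).
    apply: (@le_trans _ _ (\sum_x #|[set c | inB c && bad c x]|%:R)); last first.
      by rewrite mulr_natl -sumr_const; apply: ler_sum => x _; apply: bad_le.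
    rewrite mulr_natl -sumr_const -natr_sum.
    have -> : (\sum_x #|[set c | inB c && bad c x]|
       = \sum_(c | inB c) #|[set x | bad c x]|)%N.
      under eq_bigr do rewrite -sum1_card; under [RHS]eq_bigr do rewrite -sum1_card.
      under eq_bigr do under eq_bigl do rewrite inE.
      under [RHS]eq_bigr do under eq_bigl do rewrite inE.
      rewrite (exchange_big_dep inB) /= => [|x c _ /andP[]//].
      by apply: eq_bigr => c ->.
    rewrite natr_sum [leRHS](bigID (mem D)) /= ler_wpDr ?sumr_ge0 //.
    rewrite [leRHS](eq_bigl (mem D)) => [|c]; last by rewrite !inE; case: (inB c).
    by apply: ler_sum => c; rewrite inE => /andP[_ /ltW].
  have dN : 0 < d * N by rewrite mulr_gt0.
  by move=> DN; rewrite -(ler_pM2r dN); nra.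
pose shift (c : {ffun 'I_m -> V}) t := [ffun i => t + c i].
have [c cT] : exists c : {ffun 'I_m -> V},
    N * #|L|%:R / N ^+ m <= #|[set t | shift c t \in L]|%:R.
  apply: exists_ge_average; last first.
    by rewrite card_ffun card_ord expn_gt0; apply/orP; left; apply/card_gt0P; exists 0.
  rewrite card_ffun card_ord natrX mulrC mulfVK ?expf_neq0 ?gt_eqF //.
  have -> : \sum_(c : {ffun 'I_m -> V}) #|[set t | shift c t \in L]|%:R
      = \sum_t \sum_(c : {ffun 'I_m -> V}) (shift c t \in L)%:R :> R.
    rewrite exchange_big /=; apply: eq_bigr => c _.
    by rewrite -natr_sum -sum1_card [in LHS]big_mkcond; under eq_bigr do rewrite inE.
  rewrite mulr_natl -sumr_const; apply: ler_sum => t _.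
  rewrite [leRHS](reindex_inj (h := shift^~ t)) /=; last first.
    move=> c c' /ffunP cc; apply/ffunP => i.
    by have := cc i; rewrite !ffunE => /addrI.
  under eq_bigr => c _.
    have -> : shift (shift c t) t = c by apply/ffunP => i; rewrite !ffunE addvK.
    over.
  by rewrite -natr_sum -sum1_card [in leLHS]big_mkcond.
exists [set t | shift c t \in L], (fun x => m%:R^-1 * \sum_i ind S (x + c i)).
split.
  rewrite -ler_pdivrMr ?exprn_gt0 //.
  apply: le_trans (_ : 2 * (N * #|L|%:R / N ^+ m) <= _); last by lra.
  rewrite mulrA ler_pM2r ?invr_gt0 ?exprn_gt0 //; nra.
  move=> x; apply/andP; split.
    by rewrite mulr_ge0 ?invr_ge0 // sumr_ge0 // => i _; exact: ind_ge0.
  rewrite mulrC ler_pdivrMr ?ltr0n // mul1r -[X in _ <= X%:R]card_ord -sumr_const.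
  by apply: ler_sum => i _; exact: ind_le1.
move=> t; rewrite !inE => /andP[_]; apply: le_trans; rewrite ler_nat.
rewrite -(card_preimset _ (addrI t)) subset_leq_card //; apply/subsetP => x.
rewrite !inE /bad => lt_e.
have -> : \sum_i (ind S (t + x + shift c t i) - average B S (t + x))
   = m%:R * (m%:R^-1 * (\sum_i ind S (x + c i)) - average B S (t + x)).
  rewrite sumrB sumr_const card_ord -[_ *+ m]mulr_natl mulrBr mulVKf ?pnatr_eq0 -?lt0n //.
  congr (_ - _); apply: eq_bigr => i _; rewrite ffunE; congr (ind _ _).
  by rewrite addrACA addvv add0r.
by rewrite normrM normr_nat mulrC ltr_pM2l ?ltr0n // distrC.
Qed.

End CrootSisask.

(** * Averaging over sums of almost periods *)

Section Iterate.
Variables (R : realType) (n : nat).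
Local Notation V := 'rV['F_2]_n.
Local Notation N := (#|{: 'rV['F_2]_n}|%:R : R).
Local Notation ind := (@indicator R n).
Implicit Types (f g h : V -> R) (r s t x y z : V) (A B S T : {set V}).

(** The norm controlled here is the largest average of |h| over a translate of B
(up to the factor #|B|).  It is invariant under translations, and it is small for
bounded functions that are small off a set much sparser than B. *)
Definition small B h (c : R) := forall u, conv (ind B) (fun x => `|h x|) u <= c.

Lemma small_le B h h' (c : R) : (forall x, `|h' x| <= `|h x|) -> small B h c ->
  small B h' c.
Proof.
move=> hh sh u; apply: le_trans (sh u).
by apply: ler_sum => y _; rewrite ler_wpM2l ?ind_ge0.
Qed.

Lemma small_shift B h (c : R) z : small B h c -> small B (fun x => h (x + z)) c.
Proof.
move=> sh u; apply: le_trans (sh (u + z)).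
by apply: ler_sum => y _; rewrite addrAC.
Qed.

Lemma smallD B h h' (c c' : R) : small B h c -> small B h' c' ->
  small B (fun x => h x + h' x) (c + c').
Proof.
move=> sh sh' u; apply: le_trans (lerD (sh u) (sh' u)).
rewrite -big_split /=; apply: ler_sum => y _.
by rewrite -mulrDr ler_wpM2l ?ind_ge0 // ler_normD.
Qed.

Lemma smallZ B h (c k : R) : small B h c -> 0 <= k ->
  small B (fun x => k * h x) (k * c).
Proof.
move=> sh k0 u; apply: le_trans (ler_wpM2l k0 (sh u)).
by rewrite mulr_sumr; apply: ler_sum => y _; rewrite normrM ger0_norm // mulrCA.
Qed.

Lemma small_sum B T (h : V -> V -> R) (c : R) :
  (forall z, z \in T -> small B (h z) c) ->
  small B (fun x => \sum_z ind T z * h z x) (#|T|%:R * c).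
Proof.
move=> sh u; rewrite mulr_natl -sumr_const -sum_mem.
apply: le_trans (_ : \sum_z ind T z * conv (ind B) (fun x => `|h z x|) u <= _).
  under [leRHS]eq_bigr do rewrite mulr_sumr; rewrite exchange_big /=.
  apply: ler_sum => y _; under [leRHS]eq_bigr do rewrite mulrCA.
  rewrite -mulr_sumr ler_wpM2l ?ind_ge0 //.
  apply: le_trans (ler_norm_sum _ _ _) _; apply: ler_sum => z _.
  by rewrite normrM ger0_norm ?ind_ge0.
apply: ler_sum => z _; rewrite /indicator; case: (boolP (z \in T)) => zT.
  by rewrite !mul1r; apply: sh.
by rewrite !mul0r.
Qed.

(** Up to the factor #|T|^2, the average of f over translates by t + t', with t
and t' in T.  Two factors are used so that the multiplier on the Fourier side is
a square. *)
Definition smooth T f := conv (ind T) (conv (ind T) f).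

Lemma small_conv B T h (c : R) : small B h c ->
  small B (conv (ind T) h) (#|T|%:R * c).
Proof. by move=> sh; apply: small_sum => z _; apply: small_shift. Qed.

(** Translates of F by two elements t and t' of T are close to the same function
g; a further translation by t shows that F is close to its translate by t + t'. *)
Lemma small_smooth_sub B T (F g : V -> R) (c : R) :
  (forall t, t \in T -> small B (fun x => F (t + x) - g x) c) ->
  small B (fun x => smooth T F x - #|T|%:R ^+ 2 * F x) (#|T|%:R ^+ 2 * (c + c)).
Proof.
move=> sF; rewrite expr2 -mulrA.
apply: (@small_le _ (fun x => \sum_z ind T z * \sum_w ind T w *
    ((F (w + (x + z)) - g (x + z)) + -1 * (F (z + (x + z)) - g (x + z))))).
  move=> x; apply: le_of_eq; congr `|_|.
  transitivity (\sum_z ind T z * \sum_w ind T w * (F (x + z + w) - F x)).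
    rewrite /smooth /conv -(sum_ind R T) -mulrA mulr_suml -sumrB.
    apply: eq_bigr => z _; rewrite -mulrBr; congr (_ * _).
    rewrite mulr_suml -sumrB; apply: eq_bigr => w _; exact: esym (mulrBr _ _ _).
  apply: eq_bigr => z _; congr (_ * _); apply: eq_bigr => w _; congr (_ * _).
  by rewrite [z + (x + z)]addrC -[x + z + z]addrA addvv addr0 [w + _]addrC; ring.
apply: small_sum => z zT; apply: small_sum => w wT; apply: smallD.
  exact: (small_shift z (sF w wT)).
by apply: small_le (small_shift z (sF z zT)) => x; rewrite mulN1r normrN.
Qed.

Lemma iter_smooth_conv T k f g :
  iter k (smooth T) (conv f g) = conv f (iter k (smooth T) g).
Proof.
elim: k => //= k ->; rewrite /smooth.
by rewrite ![conv (ind T) (conv f _)]convA [conv (ind T) f]convC -!convA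
  [conv (ind T) (conv f _)]convA [conv (ind T) f]convC -convA.
Qed.

Lemma smoothB T f (c : R) g x :
  smooth T (fun y => f y - c * g y) x = smooth T f x - c * smooth T g x.
Proof.
have convB h h' z : conv (ind T) (fun y => h y - c * h' y) z
    = conv (ind T) h z - c * conv (ind T) h' z.
  by rewrite mulr_sumr -sumrB; apply: eq_bigr => y _; rewrite mulrCA -mulrBr.
rewrite /smooth -convB; congr (conv _ _ _).
by apply/funext => y; rewrite convB.
Qed.

(** Each of the k averagings contributes one error term, which the following
ones do not amplify. *)
Lemma small_iter B T (F g : V -> R) (c : R) k :
  (forall t, t \in T -> small B (fun x => F (t + x) - g x) c) ->
  small B (fun x => iter k (smooth T) F x - (#|T|%:R ^+ 2) ^+ k * F x)
    (k%:R * (#|T|%:R ^+ 2) ^+ k * (c + c)).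
Proof.
move=> sF; have s1 := small_smooth_sub sF; set t := #|T|%:R in s1 *.
elim: k => [|k IH].
  move=> u; rewrite !mul0r /conv big1 // => y _ /=.
  by rewrite expr0 mul1r subrr normr0 mulr0.
have sk := smallZ s1 (exprn_ge0 k (sqr_ge0 t)).
have := smallD (small_conv T (small_conv T IH)) sk.
rewrite -/(smooth _ _) -[#|T|%:R]/t.
rewrite (_ : t * _ + _ = k.+1%:R * (t ^+ 2) ^+ k.+1 * (c + c)); last first.
  by rewrite (exprS (t ^+ 2)) -natr1; ring.
apply: small_le => x; apply: le_of_eq; congr `|_|.
by rewrite smoothB (exprS (t ^+ 2)) /=; ring.
Qed.

Lemma hat_smooth T k f r :
  hat (iter k (smooth T) f) r = (hat (ind T) r ^+ 2) ^+ k * hat f r.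
Proof.
elim: k => [|k IH] /=; first by rewrite mul1r.
by rewrite !hat_conv IH (exprS (hat (ind T) r ^+ 2)); ring.
Qed.

Lemma smooth_ge0 T k f : (forall x, 0 <= f x) -> forall x, 0 <= iter k (smooth T) f x.
Proof.
move=> f0; elim: k => //= k IH x.
apply: sumr_ge0 => y _; rewrite mulr_ge0 ?ind_ge0 //.
by apply: sumr_ge0 => z _; rewrite mulr_ge0 ?ind_ge0.
Qed.

End Iterate.

(** * The large spectrum and dense cosets *)

Section Chang.
Variables (R : realType) (n : nat).
Local Notation V := 'rV['F_2]_n.
Local Notation N := (#|{: 'rV['F_2]_n}|%:R : R).
Local Notation ind := (@indicator R n).
Local Notation character := (@character R n).
Implicit Types (f g h : V -> R) (r s t x y z : V) (A B S T : {set V}).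

Lemma prod_character (I : finType) (J : {set I}) (F : I -> V) x :
  \prod_(i in J) character (F i) x = character (\sum_(i in J) F i) x.
Proof.
elim/big_rec2: _ => [|i a b _ ->]; first by rewrite characterC character0.
by rewrite characterDl.
Qed.

(** Expanding the product gives the characters attached to sums of subsets of
the rows, and linear independence makes all of them nontrivial but the empty one. *)
Lemma sum_riesz_product (m : nat) (M : 'M['F_2]_(m, n)) (k : R) (c : 'I_m -> R) :
  row_free M ->
  \sum_x \prod_i (k + c i * character (row i M) x) = N * k ^+ m.
Proof.
move=> freeM.
have expand x : \prod_i (k + c i * character (row i M) x)
  = \sum_(J : {set 'I_m}) (\prod_i (if i \in J then c i else k)) *
      character (\sum_(i in J) row i M) x.
  under eq_bigr do rewrite addrC; rewrite bigA_distr /=.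
  apply: eq_bigr => J _; rewrite -prod_character [X in _ * X]big_mkcond -big_split.
  by apply: eq_bigr => i _ /=; case: ifP; rewrite ?mulr1.
under eq_bigr do rewrite expand; rewrite exchange_big /= (bigD1 set0) //=.
rewrite -mulr_sumr big_set0 sum_character eqxx [X in _ + X]big1 ?addr0 => [|J J0].
  under eq_bigr do rewrite in_set0.
  by rewrite prodr_const card_ord mulrC.
rewrite -mulr_sumr sum_character ifF ?mulr0 //; apply/negP => sum0.
have [J0'|[i iJ]] := set_0Vmem J; first by rewrite J0' eqxx in J0.
pose u : 'rV['F_2]_m := \row_j (j \in J)%:R.
have uM : u *m M = \sum_(j in J) row j M.
  rewrite mulmx_sum_row [RHS]big_mkcond; apply: eq_bigr => j _.
  by rewrite mxE; case: ifP; rewrite ?scale1r ?scale0r.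
move: sum0; rewrite -uM mulmx_free_eq0 // => /eqP/rowP/(_ i).
by rewrite !mxE iJ.
Qed.

(** On T the random variable Z, an eighth of the sum of the characters taken
with the signs of their Fourier coefficients, has mean at least m / 16, so by
convexity exp Z has mean at least exp (m / 16) on T.  On the whole space the
characters are independent, and the mean of exp Z is at most exp (m / 32). *)
Lemma chang (m : nat) (M : 'M['F_2]_(m, n)) T : row_free M ->
  (forall i, #|T|%:R <= 2 * `|hat (ind T) (row i M)|) ->
  #|T|%:R * expR (m%:R / 32) <= N.
Proof.
move=> freeM large.
pose s i : R := Num.sg (hat (ind T) (row i M)).
pose Z x : R := 8^-1 * \sum_i s i * character (row i M) x.
have s1 i : `|s i| <= 1 by rewrite normr_sg; case: eqP.
have lower : #|T|%:R * expR (m%:R / 16) <= \sum_x ind T x * expR (Z x).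
  apply: (@le_trans _ _ (\sum_x ind T x *
      (expR (m%:R / 16) * (1 + (Z x - m%:R / 16))))); last first.
    apply: ler_sum => x _; rewrite ler_wpM2l ?ind_ge0 //.
    rewrite -[Z x in leRHS](subrKC (m%:R / 16)) expRD ler_wpM2l ?expR_ge0 //.
    exact: expR_ge1Dx.
  have -> : \sum_x ind T x * (expR (m%:R / 16) * (1 + (Z x - m%:R / 16)))
     = expR (m%:R / 16) * (#|T|%:R + (\sum_x ind T x * Z x - #|T|%:R * (m%:R / 16))).
    rewrite -(sum_ind R T) mulr_suml -sumrB -big_split mulr_sumr.
    by apply: eq_bigr => x _ /=; ring.
  rewrite [leLHS]mulrC ler_wpM2l ?expR_ge0 // lerDl subr_ge0.
  have -> : \sum_x ind T x * Z x = 8^-1 * \sum_i `|hat (ind T) (row i M)|.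
    under eq_bigr do rewrite /Z mulrCA mulr_sumr.
    rewrite -mulr_sumr exchange_big /=; congr (_ * _); apply: eq_bigr => i _.
    rewrite [RHS]normrEsg /hat mulr_sumr; apply: eq_bigr => x _; exact: mulrCA.
  have -> : #|T|%:R * (m%:R / 16) = 8^-1 * \sum_(i < m) #|T|%:R / 2 :> R.
    by rewrite sumr_const card_ord -[_ *+ m]mulr_natl; field.
  by rewrite ler_wpM2l ?invr_ge0 // ler_sum // => i _; have := large i; lra.
have upper : \sum_x expR (Z x) <= N * expR (m%:R / 32).
  pose k : R := 1 + 2 * 8^-1 ^+ 2.
  apply: (@le_trans _ _ (\sum_x \prod_i (k + 8^-1 * s i * character (row i M) x))).
    apply: ler_sum => x _; rewrite /Z mulr_sumr expR_sum; apply: ler_prod => i _.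
    rewrite expR_ge0 /=; set y := s i * character (row i M) x.
    have y1 : `|y| <= 1 by rewrite normrM norm_character mulr1.
    have y2 : y ^+ 2 <= 1 by rewrite -real_normK ?num_real // expr_le1.
    apply: le_trans (expR_le_quadratic _) _; first by move: y1; rewrite ler_norml; lra.
    by rewrite -mulrA -/y /k exprMn; lra.
  rewrite sum_riesz_product // ler_wpM2l //.
  have -> : m%:R / 32 = (2 * 8^-1 ^+ 2) * m%:R :> R by field.
  rewrite expRM_natr lerXn2r ?nnegrE ?expR_ge0 ?expR_ge1Dx //.
  by have := sqr_ge0 (8^-1 : R); rewrite /k; lra.
rewrite -(ler_pM2r (expR_gt0 (m%:R / 32))) -mulrA -expRD.
have -> : m%:R / 32 + m%:R / 32 = m%:R / 16 :> R by field.
apply: le_trans lower _; apply: le_trans upper; apply: ler_sum => x _.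
by rewrite ler_piMl ?expR_ge0 ?ind_le1.
Qed.

Definition spectrum T := [set r | #|T|%:R <= 2 * `|hat (ind T) r|].

(** A maximal independent family inside the large spectrum spans it and
satisfies the hypothesis of Chang's bound. *)
Lemma spectrum_basis T : exists (m : nat) (M : 'M['F_2]_(m, n)),
  [/\ row_free M, #|T|%:R * expR (m%:R / 32) <= N &
      forall r, r \in spectrum T -> exists u, r = u *m M].
Proof.
pose W := \matrix_(i < #|spectrum T|) (enum_val i : V).
exists _, (rowsub (maxrankfun W) W); split.
- exact: maxrowsub_free.
- apply: chang; first exact: maxrowsub_free.
  move=> i; rewrite row_rowsub rowK.
  by have := enum_valP (maxrankfun W i); rewrite inE.
- move=> r rT; apply/submxP; rewrite eq_maxrowsub.
  by rewrite -[r](enum_rankK_in rT rT) -(rowK (fun i => enum_val i : V)) row_sub.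
Qed.
End Chang.

Section Energy.
Variables (R : realType) (n : nat).
Local Notation V := 'rV['F_2]_n.
Local Notation ind := (@indicator R n).
Implicit Types (x y z : V) (A : {set V}).

(** Characters of the form u *m M only see x *m M^T, so orthogonality of the
characters in u detects the pairs of points of A with equal images. *)
Lemma hat_energy (m : nat) (M : 'M['F_2]_(m, n)) A :
  \sum_u hat (ind A) (u *m M) ^+ 2
  = \sum_(z in A) (#|{: 'rV['F_2]_m}| *
      #|[set x in A | x *m M^T == z *m M^T]|)%:R.
Proof.
have charM u x : character R (u *m M) x = character R u (x *m M^T).
  by rewrite /character trmx_mul trmxK mulmxA.
rewrite -sum_mem.
transitivity (\sum_z \sum_x \sum_u
    ind A z * (ind A x * character R ((x + z) *m M^T) u)).
  rewrite [RHS](eq_bigr (fun z => \sum_u \sum_x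
    ind A z * (ind A x * character R ((x + z) *m M^T) u))); last first.
    by move=> z _; exact: exchange_big.
  rewrite exchange_big /=; apply: eq_bigr => u _.
  rewrite expr2 {1}/hat mulr_suml; apply: eq_bigr => z _.
  rewrite /hat mulr_sumr; apply: eq_bigr => x _.
  by rewrite !charM !(characterC _ u) mulmxDl characterDl; ring.
apply: eq_bigr => z _; under eq_bigr do rewrite -mulr_sumr.
rewrite -mulr_sumr; congr (_ * _).
under eq_bigr do rewrite -mulr_sumr sum_character mulmxDl addv_eq0.
rewrite sum_mem natrM -sum1_card natr_sum mulr_sumr.
rewrite big_mkcond [RHS]big_mkcond; apply: eq_bigr => x _ /=.
rewrite inE; case: (x \in A) => //=; by case: eqP; rewrite ?mulr1.
Qed.

(** Some z in A attains at least the average number of collisions; the points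
colliding with z form z plus the kernel of M^T, which is parametrised by K. *)
Lemma dense_coset (m : nat) (M : 'M['F_2]_(m, n)) A (k : R) : row_free M ->
  (0 < #|A|)%N ->
  k * #|A|%:R ^+ 2 <= \sum_u hat (ind A) (u *m M) ^+ 2 ->
  exists (p : nat) (K : 'M['F_2]_(p, n)) (z : V),
    [/\ n = (p + m)%N, row_free K &
      k * #|A|%:R <= 2 ^+ m * #|[set v | v *m K + z \in A]|%:R].
Proof.
move=> freeM A0; rewrite hat_energy => le_energy.
have [z zA kz] : exists2 z, z \in A & k * #|A|%:R <=
    (#|{: 'rV['F_2]_m}| * #|[set x in A | x *m M^T == z *m M^T]|)%:R.
  apply/exists_inP; apply/contraT; rewrite negb_exists_in => /forall_inP lt_k.
  suff : k * #|A|%:R ^+ 2 < k * #|A|%:R ^+ 2 by rewrite ltxx.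
  apply: le_lt_trans le_energy _; rewrite expr2 mulrA mulr_natr -sumr_const.
  apply: ltr_sum => [|z zA]; last by rewrite ltNge lt_k.
  have /card_gt0P[z zA] := A0; apply/hasP; exists z => //; exact: mem_index_enum.
pose K := row_base (kermx M^T).
have rM : \rank M^T = m by rewrite mxrank_tr; apply/eqP.
have le_mn : (m <= n)%N by rewrite -rM rank_leq_row.
exists _, K, z; split.
- by rewrite mxrank_ker rM subnK.
- exact: row_base_free.
apply: le_trans kz _; rewrite natrM card_mx card_Fp // mul1n natrX.
rewrite ler_wpM2l ?exprn_ge0 // ler_nat.
have injK : injective (fun v => v *m K + z).
  by move=> v w /addIr/(row_free_inj (row_base_free _)).
rewrite -(card_imset _ injK).
apply/subset_leq_card/subsetP => x; rewrite inE => /andP[xA /eqP xz].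
have /submxP[v xv] : ((x + z)%R <= K)%MS.
  by rewrite eq_row_base; apply/sub_kermxP; rewrite mulmxDl xz addvv.
apply/imsetP; exists v; last by rewrite -xv -addrA addvv addr0.
by rewrite inE -xv -addrA addvv addr0.
Qed.
End Energy.

(** * The density increment *)

Lemma exponent_budget d : (0 < d -> 12 + d + 32 * d * d <= 64 * d * d)%N.
Proof.
move=> d0; have dd : (0 < d * d)%N by rewrite muln_gt0 d0.
have d_dd : (d <= d * d)%N by rewrite leq_pmull.
by rewrite -!mulnA; move: (d * d)%N dd d_dd => e e0 de; lia.
Qed.

Section Increment.
Variables (R : realType) (n : nat).
Local Notation V := 'rV['F_2]_n.
Local Notation N := (#|{: 'rV['F_2]_n}|%:R : R).
Local Notation ind := (@indicator R n).
Local Notation average := (@average R n).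
Local Notation smooth := (@smooth R n).
Local Notation spectrum := (@spectrum R n).
Local Notation selfconv := (@selfconv R n).
Implicit Types (f g h : V -> R) (r s t x y z : V) (A B S T : {set V}).

Lemma small_of_exceptions B h (e dl : R) : 0 <= e -> (forall x, `|h x| <= 1) ->
  #|[set x | e < `|h x|]|%:R <= dl -> small B h (e * #|B|%:R + dl).
Proof.
move=> e0 h1 hE u; set E := [set _ | _] in hE.
have hx x : `|h x| <= e + ind E x.
  rewrite /indicator inE; case: ltP => [_|hle]; last by rewrite addr0.
  by rewrite (le_trans (h1 x)) // lerDr.
apply: (@le_trans _ _ (\sum_y (e * ind B y + ind E (u + y)))).
  apply: ler_sum => y _; have := hx (u + y); have := normr_ge0 (h (u + y)).
  have := ind_ge0 R E (u + y).
  by rewrite /indicator; case: (y \in B); rewrite /= ?mulr1 ?mulr0 ?mul1r ?mul0r; lra.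
by rewrite big_split /= -mulr_sumr sum_ind sum_shift sum_ind lerD2l.
Qed.

(** The number of pairs of B with sum in S is the sum over B of [average B S], up
to a factor #|B|; averaging over T can be moved from the pairs to the function
[average B S], which it nearly preserves. *)
Lemma smooth_popular B S T g (e : R) k : (0 < #|B|)%N ->
  (forall t, t \in T ->
     small B (fun x => average B S (t + x) - g x) (2 * e * #|B|%:R)) ->
  31 / 32 * #|B|%:R ^+ 2 <= \sum_x conv (ind B) (ind B) x * ind S x ->
  k%:R * (4 * e) <= 1 / 32 ->
  15 / 16 * #|B|%:R ^+ 2 * (#|T|%:R ^+ 2) ^+ k <=
    \sum_x iter k (smooth T) (conv (ind B) (ind B)) x * ind S x.
Proof.
move=> B0 sF pop ke; set b := #|B|%:R in sF pop *; set t2k := (_ ^+ 2) ^+ k.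
have b0 : 0 < b by rewrite ltr0n.
have t0 : 0 <= t2k by rewrite exprn_ge0 ?sqr_ge0.
have dot0 f : \sum_x f x * ind S x = conv f (ind S) 0.
  by apply: eq_bigr => x _; rewrite add0r.
have avgE : conv (ind B) (ind S) = (fun x => b * average B S x).
  by apply/funext => x; rewrite mulVKf ?gt_eqF.
have convZ f h (c : R) : conv f (fun x => c * h x) 0 = c * conv f h 0.
  by rewrite mulr_sumr; apply: eq_bigr => x _; rewrite mulrCA.
have smoothC f h : iter k (smooth T) (conv f h) = conv (iter k (smooth T) f) h.
  by rewrite convC iter_smooth_conv convC.
have := small_iter k sF 0; rewrite -/t2k.
set F := iter k _ (average B S).
have FB : b * conv (ind B) F 0
    = \sum_x iter k (smooth T) (conv (ind B) (ind B)) x * ind S x.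
  rewrite dot0 -smoothC -convA avgE iter_smooth_conv -convZ.
  congr (conv _ _ _); apply/funext => x; rewrite -/F.
  have := iter_smooth_conv T k (fun y => b * (y == 0)%:R : R) (average B S).
  (* Multiplication by b is convolution with b times the Dirac mass at 0. *)
  have cd h : conv (fun y => b * (y == 0)%:R) h = fun y => b * h y.
    apply/funext => y; rewrite /conv (bigD1 0) //= eqxx mulr1 addr0 big1 ?addr0 //.
    by move=> z /negPf ->; rewrite mulr0 mul0r.
  by rewrite !cd => ->.
have popF : 31 / 32 * b <= conv (ind B) (average B S) 0.
  rewrite -(ler_pM2l b0) -convZ -avgE.
  by rewrite convA -dot0; move: pop; rewrite expr2; lra.
move=> smallF; rewrite -FB.
suff : 15 / 16 * b * t2k <= conv (ind B) F 0.
  by move=> hF; have := ler_wpM2l (ltW b0) hF; rewrite expr2; lra.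
have diff : t2k * conv (ind B) (average B S) 0 - conv (ind B) F 0
    <= conv (ind B) (fun x => `|F x - t2k * average B S x|) 0.
  rewrite -convZ -sumrB; apply: ler_sum => y _; rewrite -mulrBr ler_wpM2l ?ind_ge0 //.
  by rewrite distrC ler_norm.
have h1 : t2k * (31 / 32 * b) <= t2k * conv (ind B) (average B S) 0.
  by rewrite ler_wpM2l.
have h2 : k%:R * t2k * (2 * e * b + 2 * e * b) <= 1 / 32 * (t2k * b).
  have := ler_wpM2r (mulr_ge0 t0 (ltW b0)) ke; lra.
by move: smallF diff h1 h2; rewrite -/F; lra.
Qed.

Lemma norm_hat_ind A r : `|hat (ind A) r| <= #|A|%:R.
Proof.
rewrite -(sum_ind R A); apply: le_trans (ler_norm_sum _ _ _) _.
by apply: ler_sum => x _; rewrite normrM norm_character mulr1 ger0_norm ?ind_ge0.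
Qed.

Lemma sqr_hat_ind A r : hat (ind A) r ^+ 2 <= #|A|%:R ^+ 2.
Proof.
by rewrite -real_normK ?num_real // lerXn2r ?nnegrE // norm_hat_ind.
Qed.

Lemma parseval A : \sum_r hat (ind A) r ^+ 2 = N * #|A|%:R.
Proof.
under eq_bigr do rewrite expr2 -hat_conv.
rewrite sum_hat /conv; congr (_ * _); rewrite -(sum_ind R A); apply: eq_bigr => x _.
by rewrite add0r /indicator; case: (x \in A); rewrite ?mulr1 ?mulr0.
Qed.

(** As [selfconv A] is at least 3/2 on S, the hypothesis bounds from below the
correlation of the averaged convolution G with the autocorrelation of A.  In the
Fourier expansion of this correlation a character outside the spectrum of T
carries a factor 4^-k, and Parseval for A alone bounds the sum of what remains. *)
Lemma large_spectral_energy A B T k :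
  (0 < #|A|)%N -> (0 < #|B|)%N -> (0 < #|T|)%N ->
  15 / 16 * #|B|%:R ^+ 2 * (#|T|%:R ^+ 2) ^+ k <=
    \sum_x iter k (smooth T) (conv (ind B) (ind B)) x
       * ind [set x | 3 / 2 <= selfconv A x] x ->
  32 * N <= 4 ^+ k * #|A|%:R ->
  11 / 8 * #|A|%:R ^+ 2 <= \sum_(r in spectrum T) hat (ind A) r ^+ 2.
Proof.
move=> A0 B0 T0; set G := iter k _ _; set S := [set _ | _] => popG kA.
have N0 : 0 < N := card_space_gt0 R n.
have a0 : 0 < #|A|%:R :> R by rewrite ltr0n.
have b0 : 0 < #|B|%:R ^+ 2 :> R by rewrite exprn_gt0 ?ltr0n.
have t0 : 0 < #|T|%:R ^+ 2 :> R by rewrite exprn_gt0 ?ltr0n.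
set t2k := (#|T|%:R ^+ 2) ^+ k in popG.
have t2k0 : 0 < t2k by rewrite exprn_gt0.
have G0 x : 0 <= G x by apply: smooth_ge0 => {}x; apply: conv_ind_ge0.
have lower : 3 / 2 * #|A|%:R ^+ 2 * (\sum_x G x * ind S x)
    <= \sum_r hat G r * hat (ind A) r ^+ 2.
  under [leRHS]eq_bigr do rewrite expr2 -!hat_conv.
  rewrite sum_hat mulr_sumr [leRHS]mulr_sumr; apply: ler_sum => x _; rewrite add0r.
  rewrite mulrCA [leRHS]mulrCA ler_wpM2l //.
  rewrite /indicator inE; case: (lerP (3 / 2)) => [Sx|_].
    rewrite mulr1 -ler_pdivlMr ?exprn_gt0 // mulrAC; exact: Sx.
  by rewrite mulr0 mulr_ge0 ?conv_ind_ge0 // ltW.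
have upper : \sum_r hat G r * hat (ind A) r ^+ 2 <= t2k * #|B|%:R ^+ 2 *
    (\sum_(r in spectrum T) hat (ind A) r ^+ 2 + N * #|A|%:R / 4 ^+ k).
  rewrite -parseval mulr_suml [X in _ * (X + _)]big_mkcond -big_split mulr_sumr /=.
  apply: ler_sum => r _; rewrite hat_smooth hat_conv -expr2.
  have hB := sqr_hat_ind B r; have hT := sqr_hat_ind T r.
  have hA := sqr_ge0 (hat (ind A) r); have hB0 := sqr_ge0 (hat (ind B) r).
  have hT0 := exprn_ge0 k (sqr_ge0 (hat (ind T) r)).
  rewrite inE; case: (lerP #|T|%:R) => [_|small_r].
    apply: (@le_trans _ _ (t2k * #|B|%:R ^+ 2 * hat (ind A) r ^+ 2)).
      rewrite ler_wpM2r // ler_pM //.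
      by rewrite /t2k lerXn2r ?nnegrE ?sqr_ge0.
    by rewrite ler_wpM2l ?mulr_ge0 ?(ltW b0) ?(ltW t2k0) // lerDl divr_ge0 // exprn_ge0.
  rewrite add0r.
  apply: (@le_trans _ _ (t2k / 4 ^+ k * #|B|%:R ^+ 2 * hat (ind A) r ^+ 2)).
    rewrite ler_wpM2r // ler_pM //.
    rewrite /t2k -expr_div_n lerXn2r ?nnegrE ?sqr_ge0 ?divr_ge0 ?sqr_ge0 //.
    rewrite -[hat _ _ ^+ 2]real_normK ?num_real //.
    have := normr_ge0 (hat (ind T) r); nra.
  by apply: le_of_eq; ring.
have small_tail : N * #|A|%:R / 4 ^+ k <= #|A|%:R ^+ 2 / 32.
  rewrite ler_pdivrMr ?exprn_gt0 //.
  by have := ler_wpM2r (ltW a0) kA; lra.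
have := le_trans lower upper.
have := ler_wpM2l (ltW (mulr_gt0 t2k0 b0)) small_tail.
have : 3 / 2 * #|A|%:R ^+ 2 * (15 / 16 * #|B|%:R ^+ 2 * t2k)
   <= 3 / 2 * #|A|%:R ^+ 2 * (\sum_x G x * ind S x).
  by rewrite ler_wpM2l // mulr_ge0 ?sqr_ge0 //; lra.
move=> h1 h2 h3; rewrite -(ler_pM2l (mulr_gt0 t2k0 b0)).
by rewrite mulrDr in h3; lra.
Qed.

Lemma expR_ge_pow2 k : 2 ^+ k <= expR k%:R :> R.
Proof.
rewrite -[k%:R]mul1r expRM_natr lerXn2r ?nnegrE ?expR_ge0 //.
by have := expR_ge1Dx (1 : R); lra.
Qed.

(** The parameters are q = 32 d shifts, k = 8 d double averagings, accuracy
e = 1 / (2^10 d), for which the k errors add up to 1 / 32, and m samples, for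
which the exceptional sets of the sampling have relative size 4 exp (-64 d^2),
negligible against the lower bound 2^(-32 d^2) for the density of B. *)
Lemma density_increment A (d m : nat) : (0 < d)%N ->
  m%:R = 2 ^+ 29 * d%:R ^+ 4 :> R ->
  N <= 2 ^+ d * #|A|%:R ->
  N <= 2 ^+ d * #|[set x | selfconv A x == 0]|%:R ->
  exists (p c : nat) (K : 'M['F_2]_(p, n)) (z : V),
    [/\ n = (p + c)%N, (c <= 32 * (32 * d * d * m).+1)%N, row_free K &
      11 / 8 * #|A|%:R <= 2 ^+ c * #|[set v | v *m K + z \in A]|%:R :> R].
Proof.
move=> d0 mE NA NC.
have N0 : 0 < N := card_space_gt0 R n.
have dR : 1 <= d%:R :> R by rewrite ler1n.
have A0 : (0 < #|A|)%N.
  by rewrite -(ltr0n R) -(@pmulr_rgt0 _ (2 ^+ d)) ?exprn_gt0 //; apply: lt_le_trans NA.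
have m0 : (0 < m)%N by rewrite -(ltr0n R) mE mulr_gt0 ?exprn_gt0 //; lra.
pose q := (32 * d)%N.
have [B [AB B0 pop]] : exists B : {set V}, [/\ N * #|A|%:R ^+ q <= #|B|%:R * N ^+ q,
    (0 < #|B|)%N & 31 / 32 * #|B|%:R ^+ 2 <=
      \sum_x conv (ind B) (ind B) x * ind [set x | 3 / 2 <= selfconv A x] x].
  by apply: (@sift R n A q d) => //; rewrite /q; lia.
have b0 : 0 < #|B|%:R :> R by rewrite ltr0n.
have NB : N <= 2 ^+ (q * d) * #|B|%:R.
  have NqA : N ^+ q <= 2 ^+ (q * d) * #|A|%:R ^+ q.
    by rewrite mulnC exprM -exprMn lerXn2r ?nnegrE ?mulr_ge0 ?exprn_ge0 ?(ltW N0).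
  rewrite -(ler_pM2r (exprn_gt0 q N0)) -mulrA; apply: le_trans (ler_wpM2l _ AB).
    by rewrite mulrCA ler_wpM2l ?(ltW N0).
  by rewrite exprn_ge0.
pose e : R := 1 / (2 ^+ 10 * d%:R).
have e0 : 0 < e by rewrite divr_gt0 // mulr_gt0 //; lra.
have e1 : e <= 1 by rewrite ler_pdivrMr; lra.
have e01 : 0 <= e <= 1 by rewrite (ltW e0).
set S := [set x | 3 / 2 <= selfconv A x] in pop.
have [T [g [NT g01 period]]] := @almost_period R n B S m e B0 m0 e01.
have dl : 4 * expR (- (e ^+ 2 * m%:R / 8)) * N <= e * #|B|%:R.
  have -> : e ^+ 2 * m%:R / 8 = (64 * d * d)%:R.
    by rewrite mE !natrM /e; field; lra.
  have pow_d : 2 ^+ 12 * d%:R * 2 ^+ (q * d) <= 2 ^+ (64 * d * d) :> R.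
    have le_d : d%:R <= 2 ^+ d :> R by rewrite -natrX ler_nat ltnW // ltn_expl.
    apply: (@le_trans _ _ (2 ^+ 12 * 2 ^+ d * 2 ^+ (q * d))).
      by rewrite ler_wpM2r ?exprn_ge0 // ler_wpM2l ?exprn_ge0.
    by rewrite -!exprD ler_eXn2l ?ltr1n // exponent_budget.
  rewrite expRN mulrAC ler_pdivrMr ?expR_gt0 //.
  have := ler_wpM2l (mulr_ge0 (ltW e0) (ltW b0)) (le_trans pow_d (expR_ge_pow2 _)).
  have -> : e * #|B|%:R * (2 ^+ 12 * d%:R * 2 ^+ (q * d))
      = 4 * (2 ^+ (q * d) * #|B|%:R) by rewrite /e; field; lra.
  by apply: le_trans; rewrite ler_wpM2l.
have near t : t \in T ->
    small B (fun x => average B S (t + x) - g x) (2 * e * #|B|%:R).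
  move=> tT u; apply: le_trans (_ : e * #|B|%:R + e * #|B|%:R <= _); last by lra.
  apply: small_of_exceptions (ltW e0) _ (le_trans (period t tT) dl) u => x.
  have := g01 x; have := average_ge0 R B S (t + x); have := average_le1 R B S (t + x).
  by rewrite ler_norml; lra.
have T0 : (0 < #|T|)%N.
  rewrite lt0n; apply/eqP => t0; move: NT; rewrite t0 mulr0 mul0r leNgt.
  by rewrite mulr_gt0 // exprn_gt0.
have ke : (8 * d)%:R * (4 * e) <= 1 / 32.
  by rewrite natrM /e; apply: le_of_eq; field; lra.
have pop_smooth := smooth_popular B0 near pop ke.
have kA : 32 * N <= 4 ^+ (8 * d) * #|A|%:R.
  apply: (@le_trans _ _ (2 ^+ (5 + d) * #|A|%:R)); first by rewrite exprD; lra.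
  have -> : 4 = 2 ^+ 2 :> R by rewrite -natrX.
  have le_k : (5 + d <= 2 * (8 * d))%N by move: d0; clear; lia.
  by rewrite -exprM ler_wpM2r // ler_eXn2l ?ltr1n.
have energy := large_spectral_energy A0 B0 T0 pop_smooth kA.
have [c [M [freeM exp_c specM]]] := spectrum_basis R T.
have coset_energy : 11 / 8 * #|A|%:R ^+ 2 <= \sum_u hat (ind A) (u *m M) ^+ 2.
  apply: le_trans energy _.
  have -> : \sum_u hat (ind A) (u *m M) ^+ 2
      = \sum_(r in [set u *m M | u in setT]) hat (ind A) r ^+ 2.
    rewrite big_imset /=; first by apply: eq_bigl => u; rewrite inE.
    exact: in2W (row_free_inj freeM).
  rewrite [leRHS](bigID (mem (spectrum T))) /= ler_wpDr ?sumr_ge0 // => [r _|].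
    exact: sqr_ge0.
  apply: le_of_eq; apply: eq_bigl => r.
  case rT: (r \in spectrum T); rewrite ?andbF // andbT; apply/esym/imsetP.
  by have [u ->] := specM r rT; exists u; rewrite ?inE.
have [p [K [z [np freeK dense]]]] := dense_coset freeM A0 coset_energy.
exists p, c, K, z; split=> //.
have NT' : N <= 2 ^+ (32 * d * d * m).+1 * #|T|%:R.
  have Nm : N ^+ m <= 2 ^+ (q * d * m) * #|B|%:R ^+ m.
    by rewrite exprM -exprMn lerXn2r ?nnegrE ?mulr_ge0 ?exprn_ge0 ?(ltW N0).
  rewrite exprS; rewrite -/q in Nm *; set e2 := 2 ^+ (q * d * m) in Nm *.
  rewrite -(ler_pM2r (exprn_gt0 m b0)); apply: le_trans NT _.
  have := ler_wpM2l (mulr_ge0 (ler0n R 2) (ler0n R #|T|)) Nm.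
  by move/le_trans; apply; apply: le_of_eq; ring.
have : expR (c%:R / 32) <= expR ((32 * d * d * m).+1%:R) :> R.
  apply: le_trans (expR_ge_pow2 _).
  by rewrite -(ler_pM2l (_ : 0 < #|T|%:R)) ?ltr0n // [leRHS]mulrC; apply: le_trans NT'.
by rewrite ler_expR ler_pdivrMr // -natrM ler_nat mulnC.
Qed.
End Increment.

(** * Subspaces in sumsets *)

(** As long as j < d, the translates of C and of 0 by the 2^j points of the
subspace built so far do not cover the space, and any uncovered v extends it. *)
Lemma exists_avoiding_subspace (n d : nat) (C : {set 'rV['F_2]_n}) :
  (d <= n)%N -> (#|C| * 2 ^ d < 2 ^ n)%N ->
  exists D : 'M['F_2]_(d, n),
    row_free D /\ forall w, w != 0 -> w *m D \notin C.
Proof.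
move=> dn Cd; pose Z := 0 |: C.
have Zd : (#|Z| * 2 ^ d <= 2 ^ n)%N.
  have n_split : (2 ^ n = 2 ^ (n - d) * 2 ^ d)%N by rewrite -expnD subnK.
  rewrite n_split ltn_pmul2r ?expn_gt0 // in Cd.
  rewrite n_split leq_pmul2r ?expn_gt0 //.
  by apply: leq_trans Cd; rewrite cardsU1; case: (0 \notin C).
suff avoidZ j : (j <= d)%N ->
    exists D : 'M['F_2]_(j, n), forall w, w != 0 -> w *m D \notin Z.
  have [D DZ] := avoidZ d (leqnn d).
  exists D; split=> [|w w0]; last by apply: contra (DZ w w0); apply: setU1r.
  apply: inj_row_free => w wD; apply/eqP; apply: contraT => /DZ.
  by rewrite wD setU11.
elim: j => [|j IH] jd.
  by exists 0 => w; rewrite [w]thinmx0 eqxx.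
have [D DZ] := IH (ltnW jd).
have [v vZ] : exists v, v \notin [set z + w *m D | z in Z, w in [set: 'rV['F_2]_j]].
  apply/existsP; rewrite -negb_forall; apply/negP => /forallP all_in.
  have : (#|{: 'rV['F_2]_n}| <= #|Z| * #|[set: 'rV['F_2]_j]|)%N.
    apply: leq_trans (_ : #|setX Z [set: 'rV['F_2]_j]| <= _)%N; last by rewrite cardsX.
    apply: leq_trans (leq_imset_card (fun zw => zw.1 + zw.2 *m D) _).
    apply/subset_leq_card/subsetP => x _; have /imset2P[z w zZ _ ->] := all_in x.
    by apply/imsetP; exists (z, w); rewrite // inE zZ inE.
  rewrite cardsT !card_mx card_Fp // !mul1n leqNgt => /negP[].
  apply: leq_trans Zd; rewrite ltn_pmul2l ?ltn_exp2l //.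
  by apply/card_gt0P; exists 0; apply: setU11.
suff D'Z (w : 'rV_(1 + j)) : w != 0 -> w *m col_mx v D \notin Z.
  by exists (col_mx v D).
rewrite -[w](@hsubmxK _ 1 1 j); set a := lsubmx _; set w' := rsubmx _ => aw0.
rewrite mul_row_col [a]mx11_scalar mul_scalar_mx.
have [a0|a1] := F2P (a 0 0).
- rewrite a0 scale0r add0r; apply: DZ; apply: contraNneq aw0 => ->.
  by rewrite [a]mx11_scalar a0 raddf0 row_mx0.
- rewrite a1 scale1r; apply: contra vZ => vwZ; apply/imset2P.
  by exists (v + w' *m D) w'; rewrite // -addrA addvv addr0.
Qed.

Section Sumset.
Variables (R : realType).

Lemma selfconv_neq0 n (A : {set 'rV['F_2]_n}) x : selfconv R A x != 0 ->
  exists y z, [/\ y \in A, z \in A & x = y + z].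
Proof.
move=> /eqP nz.
have [y /andP[yA xyA]] : exists y, (y \in A) && (x + y \in A).
  apply/existsP; apply: contra_notT nz; rewrite negb_exists => /forallP none.
  rewrite /selfconv /conv big1 ?mulr0 // => y _; have := none y.
  by rewrite /indicator; do 2!case: (_ \in A); rewrite ?mul0r ?mulr0.
by exists y, (x + y); split; rewrite // addrCA addvv addr0.
Qed.

(** Induction on the number j of density increments still possible before the
density would exceed 1.  The sumset condition is pulled back along
v |-> v *m K + z, since the two copies of z cancel in a sum. *)
Lemma subspace_in_sumset (d m : nat) : (0 < d)%N ->
  m%:R = 2 ^+ 29 * d%:R ^+ 4 :> R ->
  forall j n (A : {set 'rV['F_2]_n}),
  2 ^+ n <= (11 / 8) ^+ j * #|A|%:R :> R ->
  2 ^+ n <= 2 ^+ d * #|A|%:R :> R ->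
  (d + j * (32 * (32 * d * d * m).+1) <= n)%N ->
  exists D : 'M['F_2]_(d, n), row_free D /\
    forall w, w != 0 -> exists y z, [/\ y \in A, z \in A & w *m D = y + z].
Proof.
move=> d0 mE; set c0 := (32 * _)%N; elim=> [|j IH] n A hj hd jn.
all: have N2 : #|{: 'rV['F_2]_n}|%:R = 2 ^+ n :> R
  by rewrite card_mx card_Fp // mul1n natrX.
all: have [le_C|lt_C] := lerP (2 ^+ n)
  (2 ^+ d * #|[set x | selfconv R A x == 0]|%:R : R).
(* The two cases where A + A is nearly everything; the other two use the
   increment, impossible when j = 0 because a density is at most 1. *)
2,4: have [||D [freeD avoidD]] :=
  @exists_avoiding_subspace n d [set x | selfconv R A x == 0]; [
    by apply: leq_trans jn; exact: leq_addr
  | by rewrite -(ltr_nat R) natrM !natrX mulrC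
  | exists D; split=> // w w0; apply: selfconv_neq0;
    by have := avoidD w w0; rewrite inE ].
all: rewrite -N2 in le_C hd.
all: have [p [c [K [z [np cc freeK dense]]]]] := density_increment d0 mE hd le_C.
  have A'le : #|[set v | v *m K + z \in A]|%:R <= 2 ^+ p :> R.
    by rewrite -natrX ler_nat (leq_trans (max_card _)) // card_mx card_Fp // mul1n.
  have := ler_wpM2l (exprn_ge0 c (ler0n R 2)) A'le.
  have : 0 < 2 ^+ n :> R by rewrite exprn_gt0.
  by move: hj; rewrite expr0 mul1r [n in 2 ^+ n]np addnC exprD; lra.
have c_gt0 : 0 < 2 ^+ c :> R by rewrite exprn_gt0.
have [||| D [freeD sumD]] := IH p [set v | v *m K + z \in A].
- rewrite -(ler_pM2l c_gt0) -exprD addnC -np; apply: le_trans hj _.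
  have j0 : 0 <= (11 / 8) ^+ j :> R by rewrite exprn_ge0 //; lra.
  by have := ler_wpM2l j0 dense; rewrite exprS; lra.
- rewrite -(ler_pM2l c_gt0) -exprD addnC -np -N2; apply: le_trans hd _.
  rewrite mulrCA ler_wpM2l ?exprn_ge0 //; apply: le_trans dense.
  by have := ler0n R #|A|; lra.
- by move: jn cc; rewrite np mulSn -/c0; clear; lia.
exists (D *m K); split.
  by move: freeD; rewrite /row_free mxrankMfree.
move=> w w0; have [y [y' [yA y'A wD]]] := sumD w w0; rewrite !inE in yA y'A.
exists (y *m K + z), (y' *m K + z); split=> //.
by rewrite mulmxA wD mulmxDl addrACA addvv addr0.
Qed.
End Sumset.

(** * Colourings *)

Section Coloring.
Variables (n : nat) (chi : line n -> color).
Implicit Types (x y z : 'rV['F_2]_n) (L : line n).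

Definition is_blue (c : color) := if c is Blue then true else false.

Definition blue_points : {set 'rV['F_2]_n} :=
  [set x : 'rV['F_2]_n | if insub <[x]>%VS is Some L then is_blue (chi L) else false].

Lemma mem_blue L x : val L = <[x]>%VS -> (x \in blue_points) = is_blue (chi L).
Proof. by move=> Lx; rewrite inE -Lx valK. Qed.

Lemma blue_points0 : 0 \notin blue_points.
Proof. by rewrite inE insubF // dim_vline eqxx. Qed.

Lemma line_generator L : exists2 x, x != 0 & val L = <[x]>%VS.
Proof.
have /eqP L1 := valP L; exists (vpick (val L)).
  by rewrite vpick0 -dimv_eq0 L1.
apply/esym/eqP; rewrite eqEdim -memvE memv_pick L1 dim_vline.
by rewrite vpick0 -dimv_eq0 L1.
Qed.

(** Colours of lines become colours of nonzero points, each line over F_2 having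
a single nonzero point. *)
Lemma monochromatic_points (c : bool) (U : {vspace 'rV['F_2]_n}) :
  (forall x, x \in U -> x != 0 -> (x \in blue_points) = c) ->
  monochromatic chi (if c then Blue else Red) U.
Proof.
move=> hU L LU; have [x x0 Lx] := line_generator L.
have xU : x \in U by move: LU; rewrite Lx memvE.
by move: (hU x xU x0); rewrite (mem_blue Lx) => <-; case: (chi L).
Qed.

Lemma red_subspace (d : nat) (D : 'M['F_2]_(d, n)) : row_free D ->
  (forall w, w != 0 -> w *m D \notin blue_points) ->
  exists2 U : {vspace 'rV['F_2]_n}, \dim U = d & monochromatic chi Red U.
Proof.
move=> freeD red; pose f : 'Hom('rV['F_2]_d, 'rV['F_2]_n) := linfun (mulmxr D).
have fE w : f w = w *m D by rewrite lfunE.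
exists (limg f).
  rewrite limg_dim_eq; first by rewrite dimvf; exact: mul1n.
  apply/eqP; rewrite -subv0; apply/subvP => w; rewrite memv_cap memv_ker fE.
  by rewrite mulmx_free_eq0 // memv0 => /andP[].
apply: (@monochromatic_points false) => x /memv_imgP[w _ ->].
rewrite fE => wD; apply/negbTE/red; apply: contraNneq wD => ->.
by rewrite mul0mx.
Qed.

Lemma blue_plane y z : y \in blue_points -> z \in blue_points ->
  y + z \in blue_points ->
  exists2 U : {vspace 'rV['F_2]_n}, \dim U = 2%N & monochromatic chi Blue U.
Proof.
move=> yB zB yzB; exists (<[y]> + <[z]>)%VS.
  have z0 : z != 0 by apply: contraNneq blue_points0 => <-.
  have : free [:: y; z].
    rewrite free_cons seq1_free z0 andbT span_seq1; apply/vlineP => -[k yk].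
    have [k0|k1] := F2P k; move: blue_points0.
      by rewrite -[0](scale0r z) -k0 -yk yB.
    by rewrite -(addvv z) -{1}[z]scale1r -k1 -yk yzB.
  by rewrite /free span_cons span_seq1 => /eqP.
apply: (@monochromatic_points true) => x.
move=> /memv_addP[_ /vlineP[a ->] [_ /vlineP[b ->] ->]].
have [->|->] := F2P a; have [->|->] := F2P b;
  rewrite ?scale0r ?scale1r ?add0r ?addr0 ?eqxx // => _.
Qed.

End Coloring.

Lemma ramsey_property_large (R : realType) (d m : nat) : (0 < d)%N ->
  m%:R = 2 ^+ 29 * d%:R ^+ 4 :> R ->
  ramsey_property 2 d (d + 3 * d * (32 * (32 * d * d * m).+1)).
Proof.
move=> d0 mE; set n := (d + _)%N => chi; set B := blue_points chi.
have red_or_blue (D : 'M['F_2]_(d, n)) : row_free D ->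
    (forall w, w != 0 -> w *m D \in B ->
       exists y z, [/\ y \in B, z \in B & w *m D = y + z]) ->
    (exists2 U : {vspace 'rV['F_2]_n}, \dim U = d & monochromatic chi Red U) \/
    (exists2 U : {vspace 'rV['F_2]_n}, \dim U = 2%N & monochromatic chi Blue U).
  move=> freeD sumD.
  have [/existsP[w /andP[w0 wB]]|] := boolP [exists w, (w != 0) && (w *m D \in B)].
    right; have [y [z [yB zB wD]]] := sumD w w0 wB.
    by apply: blue_plane yB zB _; rewrite -wD.
  rewrite negb_exists => /forallP noB; left; apply: red_subspace freeD _ => w w0.
  by have := noB w; rewrite w0.
have [sparse|dense] := ltnP (#|B| * 2 ^ d) (2 ^ n).
  have [|D [freeD avoidD]] := exists_avoiding_subspace _ sparse; first exact: leq_addr.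
  by apply: red_or_blue freeD _ => w /avoidD/negPf ->.
have denseR : 2 ^+ n <= 2 ^+ d * #|B|%:R :> R.
  by rewrite -!natrX -natrM ler_nat mulnC.
have [||D [freeD sumD]] := subspace_in_sumset d0 mE (j := 3 * d) _ denseR.
(* Three increments double the density. *)
- apply: le_trans denseR _; rewrite ler_wpM2r // exprM lerXn2r ?nnegrE //; lra.
- exact: leqnn.
by apply: red_or_blue freeD _ => w w0 _; apply: sumD.
Qed.

Theorem theorem1p2 (R : realType) :
  exists2 C : R, 0 < C &
    forall d : nat, (1 <= d)%N ->
      exists2 n : nat, is_ramsey_number 2 d n & n%:R <= C * d%:R ^+ 7.
Proof.
exists (97 + 3072 * 2 ^+ 29); first by rewrite addr_gt0 ?mulr_gt0 ?exprn_gt0.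
move=> d d0; pose m := (2 ^ 29 * d ^ 4)%N.
have mE : m%:R = 2 ^+ 29 * d%:R ^+ 4 :> R by rewrite natrM !natrX.
(* From here on m is opaque, lest its value be computed in unary. *)
move: m mE => m mE.
have large := ramsey_property_large d0 mE.
have ex : exists n, `[< ramsey_property 2 d n >].
  by eexists; apply/asboolP; exact: large.
case: (ex_minnP ex) => n /asboolP n_ramsey n_min.
exists n; first by split=> // k /asboolP; exact: n_min.
have := n_min _ (introT (asboolP _) large); rewrite -(ler_nat R) => /le_trans; apply.
have d1 : 1 <= d%:R :> R by rewrite ler1n.
rewrite natrD !natrM -[(_ * m).+1%:R]natr1 !natrM mE.
have -> : d%:R + 3 * d%:R * (32 * (32 * d%:R * d%:R * (2 ^+ 29 * d%:R ^+ 4) + 1))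
   = 97 * d%:R + 3072 * 2 ^+ 29 * d%:R ^+ 7 :> R.
  by set c := 2 ^+ 29; ring.
rewrite [leRHS]mulrDl lerD2r ler_wpM2l // -[leLHS]expr1.
by apply: ler_weXn2l.
Qed.
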